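(* Let $\pi$ be a finite projective plane of order $n$, and let $S$ be a minimal $t$-fold blocking set in $\pi$. In case $n$ is a prime power $q$, the only possible values for $t$ for which equality can be reached in the upper bound $$|S| \le \frac{1}{2}n\sqrt{4tn-(3t+1)(t-1)}+\frac{1}{2}(t-1)n+t$$ are the following: (i) $t=1$ when $q$ is a square; in this case $S$ is a unital in $\pi$. (ii) $t=q-\sqrt{q}$ when $q$ is a square; in this case $S$ is the complement of a Baer subplane in $\pi$. (iii) $t=q$ for any $q$; in this case $S$ is the plane $\pi$ with one point removed.
   Context: A $t$-fold blocking set in a projective plane $\pi$ of order $n$ is a set $S$ of points of $\pi$ such that each line of $\pi$ intersects $S$ in at least $t$ points and some line of $\pi$ intersects $S$ in exactly $t$ points. It is called minimal if every point of $S$ is contained in a line intersecting $S$ in exactly $t$ points. Let $\pi$ be a projective plane of order $n$ with $n$ a square. A unital in $\pi$ is a set of $n\sqrt{n}+1$ points of $\pi$ such that each line of $\pi$ intersects it in $1$ or $\sqrt{n}+1$ points. A Baer subplane in $\pi$ is a set of $n+\sqrt{n}+1$ points of $\pi$ such that each line of $\pi$ intersects it in $1$ or $\sqrt{n}+1$ points. Background: the upper bound in the claim is a known theorem of Bishnoi, valid for every minimal $t$-fold blocking set $S$ in a finite projective plane of order $n$. That theorem also states that if the size of $S$ equals the bound, then every line of $\pi$ intersects $S$ in exactly $t$ or $b+1$ points, where $b=\frac{1}{2}\left(\sqrt{4tn-(3t+1)(t-1)}+t-1\right)$. The claim was conjectured by Bishnoi.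
   Formalization: The formal statement assumes 1 ≤ t ≤ n; this excludes exactly the degenerate cases t = 0 with S empty and t = n+1 with S the whole plane, which also attain the bound and would be counterexamples to the claim as literally stated. *)

(* Defs.v *)
From mathcomp Require Import all_boot all_order all_algebra.
Set Implicit Arguments.
Unset Strict Implicit.
Unset Printing Implicit Defensive.

Import GRing.Theory Num.Theory.

Record projPlane := ProjPlane {
  point : finType;
  line : finType;
  inc : point -> line -> bool;
  join_uniq : forall x y : point, x != y -> exists! l : line, inc x l /\ inc y l;
  meet_uniq : forall l m : line, l != m -> exists! x : point, inc x l /\ inc x m;
  (* four points, no three of them collinear *)
  quadrangle : exists2 Q : {set point},
    #|Q| = 4 & forall l : line, #|[set x in Q | inc x l]| <= 2
}.

Definition on_line (pi : projPlane) (l : line pi) : {set point pi} :=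
  [set x | inc x l].

Definition has_order (pi : projPlane) (n : nat) : Prop :=
  forall l : line pi, #|on_line l| = n.+1.

Definition blocking_set (pi : projPlane) (t : nat) (S : {set point pi}) : Prop :=
  (forall l : line pi, t <= #|S :&: on_line l|) /\
  (exists l : line pi, #|S :&: on_line l| = t).

Definition minimal_blocking_set (pi : projPlane) (t : nat)
    (S : {set point pi}) : Prop :=
  blocking_set t S /\
  (forall x, x \in S -> exists l : line pi, inc x l /\ #|S :&: on_line l| = t).

Definition is_square (n : nat) : Prop := exists m : nat, n = m ^ 2.

(* In the next two definitions the plane has order n = m ^ 2, so m is the
   square root of n. *)
Definition unital (pi : projPlane) (S : {set point pi}) : Prop :=
  exists m : nat,
    [/\ has_order pi (m ^ 2),
        #|S| = m ^ 2 * m + 1 &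
        forall l : line pi,
          #|S :&: on_line l| = 1 \/ #|S :&: on_line l| = m + 1].

Definition Baer_subplane (pi : projPlane) (S : {set point pi}) : Prop :=
  exists m : nat,
    [/\ has_order pi (m ^ 2),
        #|S| = m ^ 2 + m + 1 &
        forall l : line pi,
          #|S :&: on_line l| = 1 \/ #|S :&: on_line l| = m + 1].

Definition prime_power (q : nat) : Prop :=
  exists p k : nat, [/\ prime p, 0 < k & q = p ^ k].

(* All operations take place in R, so no subtraction is truncated; the radicand
   is positive whenever 1 <= t <= n, so Num.sqrt is a genuine square root. *)
Definition Bishnoi_bound (R : rcfType) (n t : nat) : R :=
  (2^-1 * n%:R * Num.sqrt (4 * t%:R * n%:R - (3 * t%:R + 1) * (t%:R - 1))
   + 2^-1 * (t%:R - 1) * n%:R + t%:R)%R.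

(* Main.v *)
(* Bishnoi's bound is the larger root of a quadratic that comes from the
   variance of the line intersection sizes over the lines which are not
   t-secants. Equality forces that variance to vanish, so that all other lines
   meet S in c = b + 1 points, and forces every point of S onto exactly one
   t-secant. Counting along the lines through a point outside S, u := c - t
   divides n, while the quadratic becomes (t + u - 1) u = t (n + 1 - t). Hence
   u divides t (t - 1). When n is a prime power, u divides t or t - 1, which
   leaves only u = 1 (t = n), and n = u^2 with t = 1 or t = n - u. *)
Require Import Defs.
From mathcomp Require Import all_boot all_order all_algebra.
From mathcomp Require Import zify ring lra.

Set Implicit Arguments.
Unset Strict Implicit.
Unset Printing Implicit Defensive.

Import Order.TTheory GRing.Theory Num.Theory.

(** * Double counting of incidences *)

Definition pencil (pi : projPlane) (x : point pi) : {set line pi} :=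
  [set l | inc x l].

Lemma card_pencilI (pi : projPlane) (x y : point pi) :
  x != y -> #|pencil x :&: pencil y| = 1.
Proof.
move=> /join_uniq [l [[xl yl] uniq_l]]; apply/eqP/cards1P; exists l.
apply/setP=> m; rewrite !inE; apply/andP/eqP => [[xm ym]|->//].
by rewrite (uniq_l m).
Qed.

Lemma card_on_lineI (pi : projPlane) (l m : line pi) :
  l != m -> #|on_line l :&: on_line m| = 1.
Proof.
move=> /meet_uniq [x [[xl xm] uniq_x]]; apply/eqP/cards1P; exists x.
apply/setP=> y; rewrite !inE; apply/andP/eqP => [[yl ym]|->//].
by rewrite (uniq_x y).
Qed.

Lemma sum_incidence (pi : projPlane) (L : {set line pi}) (S : {set point pi}) :
  \sum_(l in L) #|S :&: on_line l| = \sum_(x in S) #|L :&: pencil x|.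
Proof.
transitivity (\sum_(l in L) \sum_(x in S) (inc x l : nat)).
  apply: eq_bigr => l _; rewrite -sum1_card big_mkcond [RHS]big_mkcond /=.
  by apply: eq_bigr => x _; rewrite !inE; case: (x \in S); case: (inc x l).
rewrite exchange_big /=; apply: eq_bigr => x _.
rewrite -sum1_card big_mkcond [RHS]big_mkcond /=.
by apply: eq_bigr => l _; rewrite !inE; case: (l \in L); case: (inc x l).
Qed.

(** Each point other than [x] lies on exactly one line through [x], whereas [x] itself lies on all
    of them. *)
Lemma sum_pencil (pi : projPlane) (x : point pi) (S : {set point pi}) :
  \sum_(l in pencil x) #|S :&: on_line l| =
    (x \in S) * #|pencil x| + #|S :\ x|.
Proof.
have out : \sum_(y in S :\ x) #|pencil x :&: pencil y| = #|S :\ x|.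
  rewrite -sum1_card; apply: eq_bigr => y; rewrite !inE => /andP[yx _].
  by rewrite card_pencilI // eq_sym.
rewrite sum_incidence; case: (boolP (x \in S)) => xS.
  by rewrite (big_setD1 x xS) /= setIid out mul1n.
by rewrite mul0n add0n -out (setDidPl _) // disjoint_sym disjoints1.
Qed.

Lemma sum_card_on_line (pi : projPlane) (l : line pi) :
  \sum_(x in on_line l) #|pencil x| = #|on_line l| + #|[set: line pi] :\ l|.
Proof.
under eq_bigr => x _ do rewrite -[pencil x]setTI.
rewrite -sum_incidence (big_setD1 l) ?inE //= setIid; congr (_ + _).
rewrite -sum1_card; apply: eq_bigr => m; rewrite !inE andbT => ml.
by rewrite card_on_lineI // eq_sym.
Qed.

(** * Numbers of points and lines in a plane of order [n] *)

Lemma card_point_gt3 (pi : projPlane) : 3 < #|point pi|.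
Proof. by have [Q Q4 _] := quadrangle pi; rewrite -Q4 max_card. Qed.

Lemma card_line_gt1 (pi : projPlane) : 1 < #|line pi|.
Proof.
have [Q Q4 Q2] := quadrangle pi.
have /card_gt1P [x [y [xQ yQ xy]]] : 1 < #|Q| by rewrite Q4.
have [l [[xl yl] _]] := join_uniq xy.
have [z zQ zl] : exists2 z, z \in Q & ~~ inc z l.
  apply/exists_inP; apply: contraTT (Q2 l); rewrite negb_exists_in => /forall_inP Ql.
  suff -> : [set x in Q | inc x l] = Q by rewrite Q4.
  by apply/setP=> z; rewrite inE andb_idr // => /Ql; rewrite negbK.
have xz : x != z by apply: contraNneq zl => <-.
have [m [[xm zm] _]] := join_uniq xz.
apply/card_gt1P; exists l, m; split => //.
by apply: contraNneq zl => ->.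
Qed.

Lemma card_point_pencil (pi : projPlane) (n : nat) (x : point pi) :
  has_order pi n -> #|point pi| = n * #|pencil x| + 1.
Proof.
move=> ordn; have := sum_pencil x [set: point pi].
under eq_bigr => l _ do rewrite setTI ordn.
by rewrite sum_nat_const inE -(cardsT (point pi)) (cardsD1 x [set: _]) inE /=; lia.
Qed.

Lemma card_line_pencil (pi : projPlane) (n r : nat) :
  has_order pi n -> (forall x : point pi, #|pencil x| = r) ->
  #|line pi| + n = n.+1 * r.
Proof.
move=> ordn degr; have /card_gt0P [l _] := ltnW (card_line_gt1 pi).
have := sum_card_on_line l; under eq_bigr => x _ do rewrite degr.
by rewrite sum_nat_const ordn -(cardsT (line pi)) (cardsD1 l [set: _]) inE /=; lia.
Qed.

Lemma card_pencil (pi : projPlane) (n : nat) (x : point pi) :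
  has_order pi n -> #|pencil x| = n.+1.
Proof.
move=> ordn; have v3 := card_point_gt3 pi; have N1 := card_line_gt1 pi.
have n0 : 0 < n by have := card_point_pencil x ordn; lia.
(* The number of points is [n] times the pencil size plus 1, whichever point is chosen, and [n] is
   positive. *)
have degr (y : point pi) : #|pencil y| = #|pencil x|.
  by have := card_point_pencil x ordn; have := card_point_pencil y ordn; nia.
have Nr := card_line_pencil ordn degr; have vr := card_point_pencil x ordn.
have := sum_incidence [set: line pi] [set: point pi].
under eq_bigr => l _ do rewrite setTI ordn.
under [RHS]eq_bigr => y _ do rewrite setTI degr.
rewrite !sum_nat_const !cardsT vr => Nv.
(* Eliminating the numbers of points and lines from the three counts leaves this product; pencils of
   size 1 would force a single line. *)
have {Nv} /eqP : (n%:Z * (#|pencil x|%:Z - 1) * (#|pencil x|%:Z - n.+1%:Z) = 0)%R by nia.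
rewrite !mulf_eq0 => /orP[/orP[]|] /eqP; [lia | nia | lia].
Qed.

Lemma card_line (pi : projPlane) (n : nat) :
  has_order pi n -> #|line pi| = n ^ 2 + n + 1.
Proof.
move=> ordn; have := card_line_pencil ordn (fun x => card_pencil x ordn); lia.
Qed.

Lemma card_point (pi : projPlane) (n : nat) :
  has_order pi n -> #|point pi| = n ^ 2 + n + 1.
Proof.
move=> ordn; have /card_gt0P [x _] : 0 < #|point pi| by have := card_point_gt3 pi; lia.
by rewrite (card_point_pencil x ordn) (card_pencil x ordn); lia.
Qed.

(** * First and second moments of the intersection sizes *)

Lemma sum_card_onI (pi : projPlane) (n : nat) (S : {set point pi}) :
  has_order pi n -> \sum_l #|S :&: on_line l| = #|S| * n.+1.
Proof.
move=> ordn; have := sum_incidence [set: line pi] S.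
under [RHS]eq_bigr => x _ do rewrite setTI (card_pencil x ordn).
by rewrite sum_nat_const => <-; apply: eq_bigl => l; rewrite inE.
Qed.

Lemma sum_pencil_order (pi : projPlane) (n : nat) (x : point pi)
    (S : {set point pi}) :
  has_order pi n ->
  \sum_(l in pencil x) #|S :&: on_line l| = (x \in S) * n + #|S|.
Proof.
move=> ordn; rewrite sum_pencil (card_pencil x ordn) (cardsD1 x S).
by case: (x \in S) => /=; lia.
Qed.

Lemma sum_sqr_card_onI (pi : projPlane) (n : nat) (S : {set point pi}) :
  has_order pi n ->
  \sum_l #|S :&: on_line l| ^ 2 = #|S| * (#|S| + n).
Proof.
move=> ordn.
(* One factor of the square becomes a sum over the points of [S] on [l]; after the exchange each
   such point contributes its pencil sum. *)
transitivity (\sum_l \sum_(x in S | inc x l) #|S :&: on_line l|).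
  apply: eq_bigr => l _; rewrite sum_nat_const expnS expn1; congr (_ * _).
  by apply: eq_card => x; rewrite !inE.
rewrite (exchange_big_dep (fun x => x \in S)) /=; last by move=> l x _ /andP[].
rewrite -sum_nat_const; apply: eq_bigr => x xS.
have := sum_pencil_order x S ordn; rewrite xS mul1n addnC => <-.
by apply: eq_bigl => l; rewrite inE.
Qed.

(** * Variance and the case of equality *)

(** The usual variance identity, with deviations scaled by [#|P|] so that the mean needs no
    division. *)
Lemma sum_sqr_deviation (I : finType) (P : {set I}) (f : I -> int) :
  (\sum_(i in P) (#|P|%:R * f i - \sum_(j in P) f j) ^+ 2 =
   #|P|%:R * (#|P|%:R * (\sum_(i in P) f i ^+ 2) - (\sum_(i in P) f i) ^+ 2))%R.
Proof.
set A := (\sum_(j in P) f j)%R; set C := (#|P|%:R)%R.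
transitivity (\sum_(i in P) (C ^+ 2 * f i ^+ 2 - 2 * C * A * f i + A ^+ 2))%R.
  by apply: eq_bigr => i _; ring.
rewrite big_split sumrB /= -!mulr_sumr sumr_const -[(_ *+ #|P|)%R]mulr_natl -/A -/C; ring.
Qed.

(* Put z_l := |S :&: l| - t and let T be the set of t-secants, so |T| t = |S| + e
   with e >= 0 by minimality. In any plane
   N * sum z_l^2 - (sum z_l)^2 = n |S| (N - |S|), where N = n^2 + n + 1, and the
   hypothesis amounts to sum z_l^2 = t n (N - |S|). Expanding the variance of z
   over the complement of T gives t * variance = - (N - |T|) e (sum z_l^2),
   so both sides vanish. *)
Lemma equality_two_intersection (pi : projPlane) (n t : nat) (S : {set point pi}) :
  has_order pi n -> 1 <= t <= n -> minimal_blocking_set t S ->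
  (#|S|%:Z ^+ 2 + #|S|%:Z * (n%:Z - t%:Z * n%:Z - 2 * t%:Z)
     + (n%:Z ^+ 2 + n%:Z + 1) * t%:Z * (t%:Z - n%:Z) = 0)%R ->
  exists c : nat, [/\ t < c,
    forall l : line pi, #|S :&: on_line l| = t \/ #|S :&: on_line l| = c &
    forall x, x \in S ->
      #|[set l in pencil x | #|S :&: on_line l| == t]| = 1].
Proof.
move=> ordn t_bd [[S_ge [l0 l0t]] S_min] quad.
pose k (l : line pi) := #|S :&: on_line l|.
pose T := [set l | k l == t]; pose z (l : line pi) : int := ((k l)%:Z - t%:Z)%R.
pose s := #|S|; pose N := n ^ 2 + n + 1.
have NE : (N%:Z = n%:Z ^+ 2 + n%:Z + 1)%R by rewrite /N -mulnn !PoszD PoszM.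
have nE : (n.+1%:Z = n%:Z + 1)%R by rewrite -addn1 PoszD.
rewrite -/s in quad.
have zT l : l \in T -> z l = 0%R by rewrite inE /z => /eqP->; rewrite subrr.
have sum_CT (g : line pi -> int) : (forall l, l \in T -> g l = 0)%R ->
    (\sum_(l in ~: T) g l = \sum_l g l)%R.
  move=> g0; rewrite [RHS](bigID (mem T)) /= [X in (X + _)%R]big1 // add0r.
  by apply: eq_bigl => l; rewrite inE.
have sumz : (\sum_(l in ~: T) z l = s%:Z * n.+1%:Z - N%:Z * t%:Z)%R.
  rewrite sum_CT // sumrB -(big_morph Posz PoszD (erefl _)) (sum_card_onI S ordn).
  by rewrite sumr_const (card_line ordn) PoszM -mulr_natl natz.
have sumz2 : (\sum_(l in ~: T) z l ^+ 2 =
    s%:Z * (s%:Z + n%:Z) - 2 * t%:Z * (s%:Z * n.+1%:Z) + N%:Z * t%:Z ^+ 2)%R.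
  rewrite sum_CT => [|l /zT->]; last by rewrite expr0n.
  transitivity (\sum_l ((k l ^ 2)%:Z - 2 * t%:Z * (k l)%:Z + t%:Z ^+ 2))%R.
    by apply: eq_bigr => l _; rewrite /z -mulnn PoszM; ring.
  rewrite big_split sumrB /= -mulr_sumr -!(big_morph Posz PoszD (erefl _)).
  rewrite (sum_card_onI S ordn) (sum_sqr_card_onI S ordn) sumr_const (card_line ordn).
  by rewrite -/s -/N -[(_ *+ N)%R]mulr_natl natz (PoszM s (s + n)) (PoszM s n.+1) PoszD; ring.
have tT : \sum_(x in S) #|T :&: pencil x| = #|T| * t.
  by rewrite -sum_incidence -sum_nat_const; apply: eq_bigr => l; rewrite inE => /eqP.
have T_ge1 x : x \in S -> 1 <= #|T :&: pencil x|.
  move=> /S_min [l [xl kl]]; apply/card_gt0P; exists l.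
  by rewrite !inE xl andbT; apply/eqP.
(* Excess of t-secants over one per point of [S]; [T_ge1] ensures that the subtraction is not
   truncated. *)
pose e := \sum_(x in S) (#|T :&: pencil x| - 1).
have e_def : #|T| * t = s + e.
  rewrite -tT /e /s -sum1_card -big_split; apply: eq_bigr => x /T_ge1 /=; lia.
have C_def : #|~: T| + #|T| = N by rewrite addnC cardsC (card_line ordn).
(* If [S] were the whole plane, [l0] would meet it in [n.+1 > t] points. *)
have sN : s < N.
  rewrite /N -(card_point ordn) ltn_neqAle max_card andbT.
  apply/eqP=> sv; have : S == setT by rewrite eqEcard subsetT cardsT -sv leqnn.
  by move=> /eqP ST; move: l0t; rewrite ST setTI ordn; lia.
have B_def : (\sum_(l in ~: T) z l ^+ 2 = t%:Z * n%:Z * (N%:Z - s%:Z))%R.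
  by rewrite sumz2 nE; apply/eqP; rewrite -subr_eq0 -[X in _ == X]quad NE; apply/eqP; ring.
have B_gt0 : (0 < \sum_(l in ~: T) z l ^+ 2)%R.
  rewrite B_def; apply: mulr_gt0; first by apply: mulr_gt0; lia.
  by rewrite subr_gt0; lia.
have key : (t%:Z * \sum_(i in ~: T) (#|~: T|%:R * z i - \sum_(j in ~: T) z j) ^+ 2
   = - (#|~: T|%:R * e%:Z * \sum_(l in ~: T) z l ^+ 2))%R.
  rewrite sum_sqr_deviation natz.
  have CE : (#|~: T|%:Z = N%:Z - #|T|%:Z)%R by lia.
  have TE : (#|T|%:Z * t%:Z = s%:Z + e%:Z)%R by rewrite -!PoszM -PoszD e_def.
  rewrite [RHS](_ : _ = - (#|~: T|%:Z * (#|T|%:Z * t%:Z - s%:Z) *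
      \sum_(l in ~: T) z l ^+ 2))%R; last by rewrite TE; ring.
  have A2 : ((\sum_(l in ~: T) z l) ^+ 2 =
      N%:Z * (t%:Z * n%:Z * (N%:Z - s%:Z)) - n%:Z * s%:Z * (N%:Z - s%:Z))%R.
    by rewrite -B_def sumz2 sumz nE NE; ring.
  by rewrite A2 CE B_def; ring.
have sq_ge0 : (0 <= \sum_(i in ~: T) (#|~: T|%:R * z i - \sum_(j in ~: T) z j) ^+ 2)%R.
  by apply: sumr_ge0 => l _; apply: sqr_ge0.
have [l1 l1T] : exists l, l \in ~: T.
  apply/set0Pn; apply: contraTneq B_gt0 => ->.
  by rewrite big_set0 ltxx.
have C_gt0 : 0 < #|~: T| by apply/card_gt0P; exists l1.
have CeB_ge0 : (0 <= #|~: T|%:R * e%:Z * \sum_(l in ~: T) z l ^+ 2)%R.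
  by rewrite natz; apply: mulr_ge0; [apply: mulr_ge0 | apply: ltW].
have tsq_ge0 := mulr_ge0 (isT : (0 <= t%:Z)%R) sq_ge0.
have e0 : e = 0.
  have /eqP : (#|~: T|%:R * e%:Z * \sum_(l in ~: T) z l ^+ 2 = 0)%R by lia.
  by rewrite natz !mulf_eq0 (gt_eqF B_gt0) orbF => /orP[]/eqP; lia.
have sq0 : (\sum_(i in ~: T) (#|~: T|%:R * z i - \sum_(j in ~: T) z j) ^+ 2 = 0)%R.
  have /eqP : (t%:Z * \sum_(i in ~: T) (#|~: T|%:R * z i - \sum_(j in ~: T) z j) ^+ 2 = 0)%R.
    by lia.
  by rewrite mulf_eq0 => /orP[/eqP|/eqP//]; lia.
(* Zero variance makes [z] constant off [T], so any line [l1] there supplies the second intersection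
   size. *)
have Cz l : l \in ~: T -> (#|~: T|%:Z * z l = \sum_(j in ~: T) z j)%R.
  move=> lT; apply/eqP; rewrite -subr_eq0 -sqrf_eq0 -[Posz #|~: T|]natz; apply/eqP.
  by apply: (psumr_eq0P _ sq0) => // i _; apply: sqr_ge0.
exists (k l1); split.
- by have := S_ge l1; move: l1T; rewrite !inE /k; lia.
- move=> l; case: (boolP (l \in T)) => [|lT]; first by rewrite inE => /eqP; left.
  have lC : l \in ~: T by rewrite in_setC.
  right; have := Cz l1 l1T; rewrite -(Cz l lC) => /(mulfI _) zz.
  by have : z l1 = z l by [apply: zz; lia]; rewrite /z /k; lia.
- move=> x xS; have /eqP := e0; rewrite sum_nat_eq0 => /forall_inP /(_ x xS) /eqP.
  have := T_ge1 x xS; rewrite setIC; suff -> : pencil x :&: T =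
    [set l in pencil x | #|S :&: on_line l| == t] by lia.
  by apply/setP=> l; rewrite !inE.
Qed.

(** * Arithmetic of the parameters for prime powers *)

(** Consecutive integers are coprime, so a power of [p] dividing their product divides one of
    them. *)
Lemma pfactor_dvdn_mulS (p h u m : nat) :
  prime p -> u %| p ^ h -> u %| m * m.+1 -> (u %| m) || (u %| m.+1).
Proof.
move=> p_pr /(dvdn_pfactor _ _ p_pr) [i _ ->].
case: i => [|i]; first by rewrite expn0 !dvd1n.
have [pm|pm] := boolP (p %| m).
  have cop : coprime (p ^ i.+1) m.+1.
    by rewrite coprimeXl //; apply: coprime_dvdl pm (coprimenS m).
  by rewrite Gauss_dvdl // => ->.
have cop : coprime (p ^ i.+1) m by rewrite coprimeXl // prime_coprime.
by rewrite Gauss_dvdr // => ->; rewrite orbT.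
Qed.

(* The equation b u = t (q + 1 - t) with b = t + u - 1, free of subtraction. *)
Lemma two_intersection_parameters (p h t u : nat) :
  prime p -> 0 < u -> u %| p ^ h -> 1 <= t <= p ^ h ->
  u * (t + u) + t * t = t * (p ^ h).+1 + u ->
  [\/ u = 1 /\ t = p ^ h, p ^ h = u ^ 2 /\ t = 1 | p ^ h = u ^ 2 /\ t = p ^ h - u].
Proof.
move=> p_pr u0 uq tq eq_ut.
case/dvdnP: (uq) => w qw; rewrite qw in tq eq_ut *.
have udvd : u %| t.-1 * t.-1.+1.
  have tt : t.-1 * t.-1.+1 + u * (t + u) = (t * w + 1) * u by nia.
  by rewrite -(dvdn_addl _ (dvdn_mulr (t + u) (dvdnn u))) tt dvdn_mull.
have [u1|u1] := eqVneq u 1; first by constructor 1; nia.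
case/orP: (pfactor_dvdn_mulS p_pr uq udvd) => /dvdnP[r tr].
- have {}tr : t = r * u + 1 by lia.
  case: r tr => [|r] tr; subst t; first by constructor 2; nia.
  have {tq} wr : r.+1 < w by rewrite -(ltn_pmul2r u0); lia.
  have [d wE] : exists d, w = r.+2 + d by exists (w - r.+2); lia.
  (* After cancelling [u], [d = 0] gives [u = 1], and for larger [d] the right side is too big. *)
  have : u * (r.+2 * u) = u * ((1 + r.+1 * u) * d.+1) by subst w; lia.
  move/eqP; rewrite eqn_pmul2l // => /eqP; clear -u0 u1; case: d => [|d] ur; first by lia.
  by have := leq_mul (leqnn (1 + r.+1 * u)) (isT : 2 <= d.+2); rewrite -ur; lia.
- have {}tr : t = r * u by lia.
  subst t; constructor 3.
  have r0 : 0 < r by lia.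
  have {tq} rw : r <= w by rewrite -(leq_pmul2r u0); lia.
  have [d wE] : exists d, w = r + d by exists (w - r); lia.
  (* After cancelling [u], [d = 0] gives [u = 1], [d = 1] gives [u = r.+1], and for larger [d] the
     right side is too big. *)
  have : u * (u * r + u) = u * (r * u * d + r + 1) by subst w; lia.
  move/eqP; rewrite eqn_pmul2l // {uq qw eq_ut udvd rw}wE => /eqP.
  case: d => [|[|d]] ur; first by nia.
    have -> : u = r.+1 by lia.
    by split; lia.
  have := leq_mul (leqnn (r * u)) (isT : 2 <= d.+2); have := leq_mul r0 (leqnn u); lia.
Qed.

(** * From equality in the bound to the three cases *)

Lemma Bishnoi_bound_quadratic (R : rcfType) (n t s : nat) :
  1 <= t <= n -> (s%:R)%R = Bishnoi_bound R n t ->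
  (s%:Z ^+ 2 + s%:Z * (n%:Z - t%:Z * n%:Z - 2 * t%:Z)
     + (n%:Z ^+ 2 + n%:Z + 1) * t%:Z * (t%:Z - n%:Z) = 0)%R.
Proof.
move=> /andP[t1 tn]; rewrite /Bishnoi_bound; set D := (_ - _ * _)%R => sE.
have t1R : (1 <= t%:R :> R)%R by rewrite ler1n.
have tnR : (t%:R <= n%:R :> R)%R by rewrite ler_nat.
have D_ge0 : (0 <= D)%R by rewrite /D; nra.
have rD := sqr_sqrtr D_ge0; set r := Num.sqrt D in sE rD.
apply/eqP; rewrite -(intr_eq0 R) !(rmorphD, rmorphB, rmorphM, rmorphXn, rmorph1) /= -!pmulrn.
apply/eqP; rewrite sE.
(* At the bound the quadratic is a multiple of [r ^+ 2 - D], which vanishes since [D] is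
   nonnegative. *)
transitivity (4^-1 * n%:R ^+ 2 * (r ^+ 2 - D))%R; last by rewrite rD subrr mulr0.
by rewrite /D; field.
Qed.

(** Adding [c - t] for every t-secant through [x] brings each of the [n.+1] lines through [x] up to
    [c]. *)
Lemma sum_pencil_two_intersection (pi : projPlane) (n t c : nat)
    (S : {set point pi}) (x : point pi) :
  has_order pi n -> t < c ->
  (forall l : line pi, #|S :&: on_line l| = t \/ #|S :&: on_line l| = c) ->
  (x \in S) * n + #|S| +
    #|[set l in pencil x | #|S :&: on_line l| == t]| * (c - t) = n.+1 * c.
Proof.
move=> ordn tc two; rewrite -(sum_pencil_order x S ordn) -(card_pencil x ordn).
rewrite -!sum_nat_const.
have -> : \sum_(l in [set l in pencil x | #|S :&: on_line l| == t]) (c - t) =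
    \sum_(l in pencil x) (if #|S :&: on_line l| == t then c - t else 0).
  by rewrite -big_mkcondr; apply: eq_bigl => l; rewrite !inE.
rewrite -big_split; apply: eq_bigr => l _ /=.
by case: (two l) => ->; rewrite ?eqxx; [|case: eqP]; lia.
Qed.

Theorem mainTheorem1 (R : rcfType) (pi : projPlane) (n t : nat)
    (S : {set point pi})
    (pi_order : has_order pi n)
    (n_prime_power : prime_power n)
    (t_range : 1 <= t <= n)
    (S_minimal : minimal_blocking_set t S)
    (S_equality : (#|S|%:R)%R = Bishnoi_bound R n t) :
  [\/ [/\ is_square n, t = 1 & unital S],
      exists m : nat, [/\ n = m ^ 2, t = n - m & Baer_subplane (~: S)]
    | t = n /\ exists x : point pi, S = [set~ x]].
Proof.
have quad := Bishnoi_bound_quadratic t_range S_equality.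
have [c [tc two one]] := equality_two_intersection pi_order t_range S_minimal quad.
have [p [h [p_pr _ nE]]] := n_prime_power.
have [[S_ge [l0 l0t]] _] := S_minimal.
have count x := sum_pencil_two_intersection x pi_order tc two.
have [x xS] : exists x, x \in S.
  by apply/set0Pn; apply: contraTneq (S_ge l0) => ->; rewrite set0I cards0; lia.
have [y yS] : exists y, y \notin S.
  apply/existsP; rewrite -negb_forall; apply: contraTN isT => /forallP ST.
  have /setP ST' : S =i setT by move=> z; rewrite ST inE.
  by move: l0t; rewrite ST' setTI pi_order; lia.
have := count x; rewrite xS (one x xS) mul1n => cx.
have := count y; rewrite (negPf yS) mul0n add0n => cy.
have [u cE] : exists u, c = t + u by exists (c - t); lia.
subst c; rewrite addKn mul1n in cx cy.
(* Comparing the counts at [x] in [S] and [y] outside gives [n + u = a * u], with [a] the number of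
   t-secants through [y]. *)
have u_dvd : u %| n.
  set a := #|[set _ in _ | _]| in cy.
  have /(congr1 (dvdn u)) : n + u = a * u by lia.
  by rewrite dvdn_mull // dvdn_addl.
have sE : #|S| + n = n * (t + u) + t by lia.
have eq_ut : u * (t + u) + t * t = t * n.+1 + u.
  have sZ : (#|S|%:Z = n%:Z * (t%:Z + u%:Z - 1) + t%:Z)%R by lia.
  (* Substituting the value of [#|S|] into [quad] leaves [n ^ 2] times the wanted relation. *)
  have : (n%:Z ^+ 2 * (u%:Z * (t%:Z + u%:Z) + t%:Z * t%:Z - t%:Z * n.+1%:Z - u%:Z) = 0)%R.
    by rewrite -[RHS]quad sZ (intS n); ring.
  by move=> /eqP; rewrite mulf_eq0 expf_eq0 /= => /orP[]/eqP; lia.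
have line_compl (l : line pi) : #|S :&: on_line l| + #|~: S :&: on_line l| = n.+1.
  by rewrite -(pi_order l) -(cardsID S (on_line l)) setIC setDE [~: S :&: _]setIC.
have pt_compl : #|S| + #|~: S| = n ^ 2 + n + 1 by rewrite cardsC (card_point pi_order).
have u_gt0 : 0 < u by lia.
rewrite nE in u_dvd t_range eq_ut.
case: (two_intersection_parameters p_pr u_gt0 u_dvd t_range eq_ut); rewrite -nE.
- move=> [u1 tn]; constructor 3; split=> //.
  have /cards1P [z zE] : #|~: S| == 1 by apply/eqP; nia.
  by exists z; rewrite -zE setCK.
- move=> [nu t1]; constructor 1; split=> //; first by exists u.
  exists u; split; rewrite -?nu //; first by nia.
  by move=> l; case: (two l) => ->; [left|right]; lia.
(* Here [t + u = n], so t-secants meet the complement in [u + 1] points and all other lines meet it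
   in 1. *)
- move=> [nu tu]; constructor 2; exists u; split=> //.
  have un : u <= n by rewrite nu -mulnn leq_pmulr.
  have tun : t + u = n by rewrite tu subnK.
  exists u; split; rewrite -?nu //; first by clear -tun sE pt_compl; rewrite tun in sE; lia.
  move=> l; have := line_compl l.
  by case: (two l) => ->; clear -tu un; [right|left]; lia.
Qed.
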